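(* Let $P(D)$ be a partial differential operator on $\mathbb{R}^n$ with (constant) coefficients in $\widetilde{\mathbb{C}}$, and let $N(P)$ be the set of all zeros $\zeta\in\widetilde{\mathbb{C}}^n$ of the polynomial $P$ whose imaginary part $\mathrm{Im}\,\zeta\in\widetilde{\mathbb{R}}^n$ is of log-type. If $P(D)$ is $\mathcal{G}^\infty$-hypoelliptic, then $$\mathrm{v}(|\mathrm{Re}\,\zeta|)\ge0\qquad\text{for all }\zeta\in N(P).$$
   Context: Generalized numbers: $\widetilde{\mathbb{C}}=\mathcal{E}_M/\mathcal{N}$, where $\mathcal{E}_M$ is the ring of nets $(c_\varepsilon)_\varepsilon\in\mathbb{C}^{(0,1]}$ with $|c_\varepsilon|=O(\varepsilon^{-N})$ as $\varepsilon\to0$ for some $N\in\mathbb{N}$, and $\mathcal{N}$ is the ideal of nets with $|c_\varepsilon|=O(\varepsilon^{q})$ for all $q\in\mathbb{N}$; $[(c_\varepsilon)_\varepsilon]$ denotes the class of $(c_\varepsilon)_\varepsilon$. $\widetilde{\mathbb{R}}$ is defined in the same way with real nets. The valuation is $\mathrm{v}(c)=\sup\{b\in\mathbb{R}: |c_\varepsilon|=O(\varepsilon^b)\text{ as }\varepsilon\to0\}$. For $\zeta=[(\zeta_\varepsilon)_\varepsilon]\in\widetilde{\mathbb{C}}^n$, $\mathrm{Re}\,\zeta$ and $\mathrm{Im}\,\zeta$ in $\widetilde{\mathbb{R}}^n$ and $|\mathrm{Re}\,\zeta|=[(|\mathrm{Re}\,\zeta_\varepsilon|)_\varepsilon]\in\widetilde{\mathbb{R}}$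 are defined via representatives. A point $\xi\in\widetilde{\mathbb{R}}^n$ is of log-type if it has a representative $(\xi_\varepsilon)_\varepsilon$ with $|\xi_\varepsilon|=O(\log(1/\varepsilon))$ as $\varepsilon\to0$. Colombeau algebra: for $\Omega\subseteq\mathbb{R}^n$ open, $\mathcal{G}(\Omega)=\mathcal{E}_M(\Omega)/\mathcal{N}(\Omega)$, where $\mathcal{E}_M(\Omega)$ is the set of nets $(u_\varepsilon)_\varepsilon\in C^\infty(\Omega)^{(0,1]}$ such that for all compact $K\subset\Omega$ and $\alpha\in\mathbb{N}^n$ there is $N\in\mathbb{N}$ with $\sup_{K}|\partial^\alpha u_\varepsilon|=O(\varepsilon^{-N})$, and $\mathcal{N}(\Omega)$ the set of nets such that for all $K,\alpha$ and all $q\in\mathbb{N}$, $\sup_K|\partial^\alpha u_\varepsilon|=O(\varepsilon^q)$. $\mathcal{G}^\infty(\Omega)$ is the subalgebra of those $u\in\mathcal{G}(\Omega)$ having a representative $(u_\varepsilon)_\varepsilon$ such that for every compact $K\subset\Omega$ there is $N\in\mathbb{N}$ with $\sup_K|\partial^\alpha u_\varepsilon|=O(\varepsilon^{-N})$ for all $\alpha\in\mathbb{N}^n$. For $u\in\mathcal{G}(\Omega)$, $\mathrm{sing\,supp}_{\mathcal{G}^\infty}u$ is the complement in $\Omega$ of the set of points $x\in\Omega$ such that the restriction of $u$ to some open neighborhood $V$ of $x$ belongs to $\mathcal{G}^\infty(V)$. For a polynomial $P(\zeta)=\sum_{|\alpha|\le m}c_\alpha\zeta^\alpha$ with $c_\alpha\in\widetilde{\mathbb{C}}$,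 $P(D)=\sum_{|\alpha|\le m}c_\alpha D^\alpha$ with $D=-i\partial$, acting on $\mathcal{G}(\Omega)$. $P(D)$ is $\mathcal{G}^\infty$-hypoelliptic if for every open $\Omega\subseteq\mathbb{R}^n$ and every $u\in\mathcal{G}(\Omega)$, $\mathrm{sing\,supp}_{\mathcal{G}^\infty}P(D)u=\mathrm{sing\,supp}_{\mathcal{G}^\infty}u$. *)

(* Defs.v *)
From HB Require Import structures.
From mathcomp Require Import all_boot all_order all_algebra.
From mathcomp Require Import generic_quotient ring_quotient complex.
From mathcomp Require Import boolp classical_sets functions reals ereal.
From mathcomp Require Import interval_inference topology normedtype derive exp.
From mathcomp Require Import ring lra.
Set Implicit Arguments.
Unset Strict Implicit.
Unset Printing Implicit Defensive.
Import Order.TTheory GRing.Theory Num.Theory numFieldNormedType.Exports.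
Local Open Scope classical_set_scope.
Local Open Scope ring_scope.
Local Open Scope quotient_scope.

Section Schwarz.
Variables (R : realType) (V : normedModType R).
Implicit Types (f : V -> R) (x a b : V).

Lemma is_derive_line f x a (t : R) : derivable f (x + t *: a) a ->
  is_derive t 1 (fun s => f (x + s *: a)) ('D_a f (x + t *: a)).
Proof.
move=> df.
have E : (fun h : R => h^-1 *: (((fun s => f (x + s *: a)) \o shift t) (h *: 1) -
    f (x + t *: a))) =
  (fun h => h^-1 *: ((f \o shift (x + t *: a)) (h *: a) - f (x + t *: a))).
  apply/funext => h /=; congr (_ *: (f _ - _)).
  by rewrite scalerDl [h%:A]mulr1 addrCA.
by split; rewrite /derivable /derive E.
Qed.

Lemma MVT_line f x a (h : R) : 0 < h ->
  (forall t, 0 <= t <= h -> derivable f (x + t *: a) a) ->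
  exists2 c, 0 < c < h & f (x + h *: a) - f x = h * 'D_a f (x + c *: a).
Proof.
move=> h0 df.
have [||c] := @MVT R (fun s => f (x + s *: a)) (fun s => 'D_a f (x + s *: a)) _ _ h0.
- move=> t; rewrite in_itv/= => /andP[t0 th]; apply: is_derive_line.
  by apply: df; rewrite !ltW.
- apply: derivable_within_continuous => t; rewrite in_itv/= => tI.
  by have [] := is_derive_line (df _ tI).
by rewrite in_itv/= scale0r addr0 subr0 mulrC; exists c.
Qed.

Definition diff2 f x a b (h : R) :=
  f (x + h *: b + h *: a) - f (x + h *: b) - (f (x + h *: a) - f x).

Lemma diff2C f x a b h : diff2 f x a b h = diff2 f x b a h.
Proof. by rewrite /diff2 (addrAC x); lra. Qed.

Lemma diff2_MVT f x a b :
  (\forall y \near x, derivable f y a) ->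
  (\forall y \near x, derivable ('D_a f) y b) ->
  {for x, continuous ('D_b ('D_a f))} ->
  forall e, 0 < e -> \forall h \near 0^'+,
    `|diff2 f x a b h - h * h * 'D_b ('D_a f) x| <= h * h * e.
Proof.
move=> dfa dfb cD e e0.
move: (cD) => /cvgr_dist_le/(_ e e0) cD'.
have /nbhs_ballP[r /= r0 Hr] : \forall y \near x, [/\ derivable f y a,
   derivable ('D_a f) y b & `|'D_b ('D_a f) x - 'D_b ('D_a f) y| <= e].
  by apply: filterS3 dfa dfb cD' => y; split.
have M0 : 0 < `|a| + `|b| + 1 by rewrite ltr_wpDl ?addr_ge0.
have rM0 : 0 < r / (`|a| + `|b| + 1) by rewrite divr_gt0.
near=> h.
have h0 : 0 < h by near: h; exact: nbhs_right_gt.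
have hr : h * (`|a| + `|b| + 1) < r.
  by rewrite -ltr_pdivlMr//; near: h; exact: nbhs_right_lt.
have inb (s t : R) : 0 <= s <= h -> 0 <= t <= h -> ball x r (x + s *: b + t *: a).
  move=> /andP[s0 sh] /andP[t0 th].
  rewrite -ball_normE /ball_/= -addrA opprD addNKr normrN.
  rewrite (le_lt_trans (ler_normD _ _))// (le_lt_trans _ hr)// !normrZ !ger0_norm//.
  have := normr_ge0 a; have := normr_ge0 b; nra.
have hh : 0 <= h <= h by rewrite lexx ltW.
have h00 : 0 <= (0 : R) <= h by rewrite lexx ltW.
pose g y := f (y + h *: b) - f y.
have dg1 (t : R) : 0 <= t <= h -> is_derive (x + t *: a) a g
   ('D_a f (x + t *: a + h *: b) - 'D_a f (x + t *: a)).
  move=> tI; apply: is_deriveB.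
    have [d1 _ _] := Hr _ (inb _ _ hh tI).
    rewrite addrAC in d1.
    have E : (fun k : R => k^-1 *: (((fun y => f (y + h *: b)) \o shift (x + t *: a)) (k *: a) -
        f (x + t *: a + h *: b))) =
      (fun k => k^-1 *: ((f \o shift (x + t *: a + h *: b)) (k *: a) - f (x + t *: a + h *: b))).
      by apply/funext => k /=; rewrite !addrA.
    by split; rewrite /derivable /derive E.
  apply: derivableP.
  by have [+ _ _] := Hr _ (inb _ _ h00 tI); rewrite scale0r addr0.
have [t /dg1 dgt|c /andP[c0 ch]] := @MVT_line g x a h h0; first by case: dgt.
have cI : 0 <= c <= h by rewrite !ltW.
have [_ ->] := dg1 _ cI.
have [t /inb/(_ cI) /Hr[_ + _]|d /andP[d0 dh]] := @MVT_line ('D_a f) (x + c *: a) b h h0.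
  by rewrite addrAC.
move=> -> E.
have dI : 0 <= d <= h by rewrite !ltW.
have [_ _] := Hr _ (inb _ _ dI cI).
rewrite addrAC => H.
have -> : diff2 f x a b h = h * (h * 'D_b ('D_a f) (x + c *: a + d *: b)).
  by rewrite -E /g /diff2 (addrAC x); lra.
rewrite mulrA -mulrBr normrM distrC ger0_norm ?mulr_ge0 ?(ltW h0)//.
by rewrite ler_wpM2l ?mulr_ge0 ?(ltW h0).
Unshelve. all: by end_near. Qed.

Lemma Schwarz f x a b :
  (\forall y \near x, derivable f y a) ->
  (\forall y \near x, derivable f y b) ->
  (\forall y \near x, derivable ('D_a f) y b) ->
  (\forall y \near x, derivable ('D_b f) y a) ->
  {for x, continuous ('D_b ('D_a f))} ->
  {for x, continuous ('D_a ('D_b f))} ->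
  'D_b ('D_a f) x = 'D_a ('D_b f) x.
Proof.
move=> da db dab dba cab cba.
apply/eqP; rewrite -subr_eq0 -normr_le0; apply/ler_addgt0Pl => e e0.
rewrite addr0.
have e20 : 0 < e / 2 by rewrite divr_gt0.
have Hab := diff2_MVT da dab cab e20.
have Hba := diff2_MVT db dba cba e20.
have [h [h0 H1 H2]] := filter_ex (filterS3 _ (fun h h0 H1 H2 => And3 h0 H1 H2)
  (nbhs_right_gt 0) Hab Hba).
rewrite (diff2C f x b a h) in H2; clear Hab Hba.
have hh : 0 < h * h by rewrite mulr_gt0.
rewrite -(ler_pM2l hh) -{1}(gtr0_norm hh) -normrM mulrBr.
rewrite -(subrKA (diff2 f x a b h)).
apply: le_trans (ler_normD _ _) _; rewrite distrC.
have -> : h * h * e = h * h * (e / 2) + h * h * (e / 2) by rewrite -mulrDr -splitr.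
apply: lerD.
  exact: H1.
exact: H2.
Qed.

End Schwarz.

Section Pderiv.
Variables (R : realType) (n : nat).
Local Notation E := 'rV[R]_n.
Implicit Types (f g : E -> R) (s t : seq 'I_n).

(* Iterated partial derivatives along the list of directions s. *)
Definition pderivs s f : E -> R :=
  foldr (fun j g => 'D_(delta_mx 0 j) g) f s.

(* C^oo on D: all iterated partial derivatives exist and are continuous at every
   point of D.  The functions are total; their values outside D play no role
   when D is open. *)
Definition smooth_real (D : set E) f : Prop := forall s x, D x ->
  {for x, continuous (pderivs s f)} /\
  forall j, derivable (pderivs s f) x (delta_mx 0 j).

(* The list with al i copies of each i, so that pderivs (word al) is the
   derivative with multi-index al. *)
Definition word (al : 'I_n -> nat) : seq 'I_n :=
  flatten [seq nseq (al i) i | i <- enum 'I_n].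

Lemma pderivs_cat s t f : pderivs (s ++ t) f = pderivs s (pderivs t f).
Proof. exact: foldr_cat. Qed.

Lemma perm_word (al be : 'I_n -> nat) :
  perm_eq (word al ++ word be) (word (fun i => (al i + be i)%N)).
Proof.
rewrite /word; elim: (enum _) => //= i r IH.
by rewrite nseqD -!catA perm_cat2l perm_catCA perm_cat2l.
Qed.

Variable D : set E.
Hypothesis oD : open D.

Lemma pderivs_eq s f g : {in D, f =1 g} -> {in D, pderivs s f =1 pderivs s g}.
Proof.
move=> fg; elim: s => //= j s IH x; rewrite inE => Dx.
apply: near_eq_derive; apply: filterS (open_nbhs_nbhs (conj oD Dx)) => y Dy.
by apply: IH; rewrite inE.
Qed.

Lemma smooth_eq f g : {in D, f =1 g} -> smooth_real D f -> smooth_real D g.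
Proof.
move=> fg sf s x Dx; have [cf df] := sf s x Dx.
have E : \near x, pderivs s f x = pderivs s g x.
  apply: filterS (open_nbhs_nbhs (conj oD Dx)) => y Dy.
  by apply: (pderivs_eq s fg); rewrite inE.
split=> [|j]; last exact: near_eq_derivable (df j).
rewrite /prop_for/continuous_at -(nbhs_singleton E).
exact: cvg_trans (near_eq_cvg E) cf.
Qed.

Lemma pderivs_comb s (a b : R) f g : smooth_real D f -> smooth_real D g ->
  {in D, pderivs s (fun x => a * f x + b * g x) =1
         (fun x => a * pderivs s f x + b * pderivs s g x)}.
Proof.
move=> sf sg; elim: s => //= j s IH x; rewrite inE => Dx.
rewrite (@near_eq_derive _ _ _ _
  ((a *: pderivs s f : E -> R) + (b *: pderivs s g : E -> R))); last first.
  apply: filterS (open_nbhs_nbhs (conj oD Dx)) => y Dy.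
  by rewrite IH ?inE.
have [_ /(_ j) df] := sf s x Dx; have [_ /(_ j) dg] := sg s x Dx.
rewrite (deriveD (derivableZ (k:=a) df) (derivableZ (k:=b) dg)).
by rewrite (@deriveZ _ _ _ _ a _ _ df) (@deriveZ _ _ _ _ b _ _ dg).
Qed.

Lemma smooth_comb (a b : R) f g : smooth_real D f -> smooth_real D g ->
  smooth_real D (fun x => a * f x + b * g x).
Proof.
move=> sf sg s x Dx; have [cf df] := sf s x Dx; have [cg dg] := sg s x Dx.
have E : \near x, ((a *: pderivs s f : E -> R) + (b *: pderivs s g : E -> R)) x
   = pderivs s (fun x => a * f x + b * g x) x.
  apply: filterS (open_nbhs_nbhs (conj oD Dx)) => y Dy.
  by rewrite pderivs_comb ?inE.
split=> [|j]; last first.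
  by apply: near_eq_derivable E _; apply: derivableD; apply: derivableZ.
rewrite /prop_for/continuous_at -(nbhs_singleton E).
apply: cvg_trans (near_eq_cvg E) _.
by apply: cvgD; apply: cvgZr.
Qed.

Lemma smooth_pderivs s f : smooth_real D f -> smooth_real D (pderivs s f).
Proof. by move=> sf t x; rewrite -pderivs_cat; apply: sf. Qed.

Lemma pderivsC i j f : smooth_real D f ->
  {in D, pderivs [:: i; j] f =1 pderivs [:: j; i] f}.
Proof.
move=> sf x; rewrite inE => Dx /=.
have nD := open_nbhs_nbhs (conj oD Dx).
apply: Schwarz.
- by apply: filterS nD => y Dy; exact: (sf [::] y Dy).2.
- by apply: filterS nD => y Dy; exact: (sf [::] y Dy).2.
- by apply: filterS nD => y Dy; exact: (sf [:: j] y Dy).2.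
- by apply: filterS nD => y Dy; exact: (sf [:: i] y Dy).2.
- by have [] := sf [:: i; j] x Dx.
- by have [] := sf [:: j; i] x Dx.
Qed.

Lemma pderivs_perm s t f : perm_eq s t -> smooth_real D f ->
  {in D, pderivs s f =1 pderivs t f}.
Proof.
elim: s t => [|i s IH] t st sf; first by rewrite perm_sym in st; rewrite (perm_nilP st).
have it : i \in t by rewrite -(perm_mem st) mem_head.
case/splitPr: it st => t1 t2; rewrite perm_sym perm_catC /= perm_cons perm_catC perm_sym.
move=> st x Dx.
transitivity (pderivs (i :: t1 ++ t2) f x).
  by apply: (@pderivs_eq [:: i] _ _ _ x Dx) => y; exact: IH.
elim: t1 {st} x Dx => [//|j t1 IH1 x Dx].
transitivity (pderivs [:: j; i] (pderivs (t1 ++ t2) f) x).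
  exact: (@pderivsC i j _ (smooth_pderivs _ sf) x Dx).
by apply: (@pderivs_eq [:: j] _ _ _ x Dx) => y; exact: IH1.
Qed.

End Pderiv.

Section BigO.
Variable R : realType.

Definition I01 : Type := {e : R | 0 < e <= 1}.
HB.instance Definition _ := Choice.on I01.

Fact I01_1 : 0 < (1 : R) <= 1. Proof. by rewrite ltr01 lexx. Qed.
HB.instance Definition _ := isPointed.Build I01 (exist _ 1 I01_1).

Implicit Type r : I01 -> R.

(* sup_(x in K) g e x = O(r e) as e -> 0, for g >= 0. *)
Definition bigO_on (T : Type) (K : set T) (g : I01 -> T -> R) r : Prop :=
  exists C e0 : R, 0 < e0 /\
    forall e : I01, val e < e0 -> forall x, K x -> g e x <= C * r e.

Definition bigO (g : I01 -> R) r : Prop :=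
  bigO_on [set: unit] (fun e _ => g e) r.

Lemma I01_gt0 (e : I01) : 0 < val e. Proof. by case/andP: (valP e). Qed.
Lemma I01_le1 (e : I01) : val e <= 1. Proof. by case/andP: (valP e). Qed.

Section Rules.
Variables (T : Type) (K : set T).
Implicit Types g h : I01 -> T -> R.

Lemma bigO_on_le g h r : (forall e x, K x -> g e x <= h e x) ->
  bigO_on K h r -> bigO_on K g r.
Proof.
move=> gh [C [e0 [e0_gt0 H]]]; exists C, e0; split => // e ee0 x Kx.
by rewrite (le_trans (gh _ _ Kx)) ?H.
Qed.

Lemma bigO_on_ler g r r' : (forall e, 0 <= r e <= r' e) ->
  bigO_on K g r -> bigO_on K g r'.
Proof.
move=> rr' [C [e0 [e0_gt0 H]]]; exists `|C|, e0; split => // e ee0 x Kx.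
have /andP[r0 r1] := rr' e.
rewrite (le_trans (H _ ee0 _ Kx))// (le_trans (y := `|C| * r e))//.
  by rewrite ler_wpM2r ?ler_norm.
by rewrite ler_wpM2l.
Qed.

Lemma bigO_onD g h r : bigO_on K g r -> bigO_on K h r ->
  bigO_on K (fun e x => g e x + h e x) r.
Proof.
move=> [C [e0 [e0_gt0 H]]] [C' [e0' [e0'_gt0 H']]].
exists (C + C'), (Num.min e0 e0'); split; first by rewrite lt_min e0_gt0.
by move=> e; rewrite lt_min => /andP[e1 e2] x Kx; rewrite mulrDl lerD ?H ?H'.
Qed.

Lemma bigO_onM g h r r' : (forall e x, 0 <= g e x) -> (forall e x, 0 <= h e x) ->
  bigO_on K g r -> bigO_on K h r' ->
  bigO_on K (fun e x => g e x * h e x) (fun e => r e * r' e).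
Proof.
move=> g0 h0 [C [e0 [e0_gt0 H]]] [C' [e0' [e0'_gt0 H']]].
exists (C * C'), (Num.min e0 e0'); split; first by rewrite lt_min e0_gt0.
move=> e; rewrite lt_min => /andP[e1 e2] x Kx.
by rewrite mulrACA ler_pM ?H ?H'.
Qed.

Lemma bigO_const (g : I01 -> R) r : bigO g r -> bigO_on K (fun e _ => g e) r.
Proof.
by move=> [C [e0 [? H]]]; exists C, e0; split => // e ? x _; apply: (H e _ tt).
Qed.

Lemma bigO_on0 r : bigO_on K (fun _ _ => 0) r.
Proof. by exists 0, 1; split => // e _ x _; rewrite mul0r. Qed.

Lemma bigO_on_negX g N N' : (N <= N')%N ->
  bigO_on K g (fun e => (val e) ^- N) -> bigO_on K g (fun e => (val e) ^- N').
Proof.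
move=> NN'; apply: bigO_on_ler => e; have e0 := I01_gt0 e.
rewrite invr_ge0 exprn_ge0 ?(ltW e0)//= lef_pV2 ?posrE ?exprn_gt0//.
by rewrite ler_wiXn2l ?I01_le1 // (ltW e0).
Qed.

Lemma bigO_on_X g N N' : (N' <= N)%N ->
  bigO_on K g (fun e => (val e) ^+ N) -> bigO_on K g (fun e => (val e) ^+ N').
Proof.
move=> NN'; apply: bigO_on_ler => e; have e0 := I01_gt0 e.
by rewrite exprn_ge0 ?(ltW e0)//= ler_wiXn2l ?I01_le1 // (ltW e0).
Qed.

Definition mod_bound g := exists N : nat, bigO_on K g (fun e => (val e) ^- N).
Definition neg_bound g := forall q : nat, bigO_on K g (fun e => (val e) ^+ q).

Lemma mod_boundD g h : mod_bound g -> mod_bound h ->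
  mod_bound (fun e x => g e x + h e x).
Proof.
move=> [N H] [N' H']; exists (maxn N N'); apply: bigO_onD.
  exact: bigO_on_negX (leq_maxl _ _) H.
exact: bigO_on_negX (leq_maxr _ _) H'.
Qed.

Lemma neg_boundD g h : neg_bound g -> neg_bound h ->
  neg_bound (fun e x => g e x + h e x).
Proof. by move=> H H' q; apply: bigO_onD. Qed.

Lemma mod_boundM g h : (forall e x, 0 <= g e x) -> (forall e x, 0 <= h e x) ->
  mod_bound g -> mod_bound h -> mod_bound (fun e x => g e x * h e x).
Proof.
move=> g0 h0 [N H] [N' H']; exists (N + N')%N.
have -> : (fun e : I01 => val e ^- (N + N')) = fun e => val e ^- N * val e ^- N'.
  by apply/funext => e; rewrite exprD invfM.
exact: bigO_onM.
Qed.

Lemma neg_boundM g h : (forall e x, 0 <= g e x) -> (forall e x, 0 <= h e x) ->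
  mod_bound g -> neg_bound h -> neg_bound (fun e x => g e x * h e x).
Proof.
move=> g0 h0 [N H] H' q.
have -> : (fun e : I01 => val e ^+ q) = fun e => val e ^- N * val e ^+ (N + q).
  apply/funext => e; rewrite exprD mulKf// expf_neq0//.
  by rewrite gt_eqF ?I01_gt0.
exact: bigO_onM.
Qed.

Lemma neg_mod_bound g : neg_bound g -> mod_bound g.
Proof. by move=> /(_ 0%N) H; exists 0%N; move: H; under [fun e : I01 => _ ^- _]funext do rewrite invr1. Qed.

Lemma mod_bound_le g h : (forall e x, K x -> g e x <= h e x) ->
  mod_bound h -> mod_bound g.
Proof. by move=> gh [N H]; exists N; apply: bigO_on_le H. Qed.

Lemma neg_bound_le g h : (forall e x, K x -> g e x <= h e x) ->
  neg_bound h -> neg_bound g.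
Proof. by move=> gh H q; apply: bigO_on_le (H q). Qed.

Lemma mod_bound0 : mod_bound (fun _ _ => 0).
Proof. by exists 0%N; apply: bigO_on0. Qed.

Lemma neg_bound0 : neg_bound (fun _ _ => 0).
Proof. by move=> q; apply: bigO_on0. Qed.

Lemma mod_boundC (c : R) : mod_bound (fun _ _ => c).
Proof.
exists 0%N, c, 1; split => // e _ x _.
by rewrite expr0 invr1 mulr1.
Qed.

End Rules.

End BigO.

Section GeneralizedNumbers.
Variables (R : realType) (V : normedZmodType R).
Implicit Type c : I01 R -> V.

Definition moderate_num : {pred (I01 R -> V)} := [pred c : I01 R -> V |
  `[< exists N : nat, bigO (fun e => `|c e|) (fun e => (val e) ^- N) >] ].

Lemma moderate_numP c :
  reflect (mod_bound [set: unit] (fun e _ => `|c e|)) (c \in moderate_num).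
Proof. exact: asboolP. Qed.

Fact moderate_num_zmod : zmod_closed moderate_num.
Proof.
split=> [|c d /moderate_numP Hc /moderate_numP Hd]; apply/moderate_numP.
  by apply: mod_bound_le (mod_bound0 _ _) => e x _; rewrite normr0.
by apply: mod_bound_le (mod_boundD Hc Hd) => e x _; exact: ler_normB.
Qed.
HB.instance Definition _ :=
  GRing.isZmodClosed.Build (I01 R -> V) moderate_num moderate_num_zmod.

Record mnum := Mnum {
  mnum_net :> I01 R -> V;
  mnum_moderate : mnum_net \in moderate_num }.
HB.instance Definition _ := [isSub for mnum_net].
HB.instance Definition _ := [Choice of mnum by <:].
HB.instance Definition _ := [SubChoice_isSubZmodule of mnum by <:].

Definition negligible_num : {pred mnum} := [pred c : mnum |
  `[< forall q : nat, bigO (fun e => `|c e|) (fun e => (val e) ^+ q) >] ].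

Lemma negligible_numP (c : mnum) :
  reflect (neg_bound [set: unit] (fun e _ => `|c e|)) (c \in negligible_num).
Proof. exact: asboolP. Qed.

Fact negligible_num_zmod : zmod_closed negligible_num.
Proof.
split=> [|c d /negligible_numP Hc /negligible_numP Hd]; apply/negligible_numP.
  by apply: neg_bound_le (neg_bound0 _ _) => e x _; rewrite normr0.
by apply: neg_bound_le (neg_boundD Hc Hd) => e x _; exact: ler_normB.
Qed.
HB.instance Definition _ :=
  GRing.isZmodClosed.Build mnum negligible_num negligible_num_zmod.

End GeneralizedNumbers.

Section Ctilde.
Variable R : realType.
Local Notation C := (Rcomplex R).

Fact moderate_num_mulr : mulr_closed (@moderate_num R C).
Proof.
split=> [|c d /moderate_numP Hc /moderate_numP Hd]; apply/moderate_numP.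
  apply: mod_bound_le (mod_boundC _ 1) => e x _.
  by rewrite [leLHS](@Normc.normc1 R).
apply: mod_bound_le (mod_boundM _ _ Hc Hd) => // e x _.
by rewrite [leLHS](@Normc.normcM R).
Qed.
HB.instance Definition _ :=
  GRing.isMulClosed.Build (I01 R -> C) (@moderate_num R C) moderate_num_mulr.
HB.instance Definition _ := [SubZmodule_isSubNzRing of mnum C by <:].
HB.instance Definition _ := [SubNzRing_isSubComNzRing of mnum C by <:].

Fact negligible_num_ideal : 1 \notin @negligible_num R C /\
  forall a, {in @negligible_num R C, forall u, a * u \in @negligible_num R C}.
Proof.
split=> [|c d /negligible_numP H].
  apply/negP => /negligible_numP /(_ 1%N)[K [e0 [e00 H]]].
  have e1_gt0 : 0 < Num.min (Num.min 1 (e0 / 2)) (`|K| + 1)^-1.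
    by rewrite !lt_min ltr01 divr_gt0//= invr_gt0 ltr_wpDl.
  set e1 := Num.min _ _ in e1_gt0.
  have e1_le1 : 0 < e1 <= 1 by rewrite e1_gt0 /e1 !ge_min lexx.
  have e1_lt : e1 < e0.
    rewrite (le_lt_trans (y := e0 / 2)) ?ltr_pdivrMr ?ltr_pMr ?ltr1n//.
    by rewrite /e1 !ge_min lexx orbT.
  have := H (exist _ e1 e1_le1) e1_lt tt I.
  rewrite [X in X <= _](@Normc.normc1 R) expr1 /=; apply/negP; rewrite -ltNge.
  rewrite (le_lt_trans (y := `|K| * e1)) ?ler_wpM2r ?ler_norm ?ltW//.
  rewrite (lt_le_trans (y := (`|K| + 1) * e1)) ?ltr_pM2r ?ltrDl//.
  by rewrite -ler_pdivlMl ?mulr1 ?ltr_wpDl// /e1 ge_min lexx orbT.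
apply/negligible_numP; have /moderate_numP Hc := mnum_moderate c.
apply: neg_bound_le (neg_boundM _ _ Hc H) => // e x _.
by rewrite [leLHS](@Normc.normcM R).
Qed.
HB.instance Definition _ :=
  isProperIdeal.Build (mnum C) (@negligible_num R C) negligible_num_ideal.

Definition Ctilde := {ideal_quot (@negligible_num R C)}.
HB.instance Definition _ := GRing.ComNzRing.on Ctilde.
HB.instance Definition _ := NzRingQuotient.on Ctilde.
Definition Rtilde := Quotient.quot (@negligible_num R R).
HB.instance Definition _ := GRing.Zmodule.on Rtilde.
HB.instance Definition _ := ZmodQuotient.on Rtilde.

End Ctilde.

Section Cpderiv.
Variables (R : realType) (n : nat).
Local Notation E := 'rV[R]_n.
Local Notation C := (Rcomplex R).
Implicit Types (f g : E -> C) (al : 'I_n -> nat).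

(* [Rcomplex R] is R[i] as a normed space over R, its norm being Normc.normc.
   It carries no derivative in the library, whence the componentwise
   definitions of derivation and smoothness. *)
Definition cpderiv al f : E -> C := fun x =>
  (pderivs (word al) (fun y => complex.Re (f y)) x +i*
   pderivs (word al) (fun y => complex.Im (f y)) x)%C.

Definition smooth (D : set E) f : Prop :=
  smooth_real D (fun y => complex.Re (f y)) /\ smooth_real D (fun y => complex.Im (f y)).

Variable D : set E.
Hypothesis oD : open D.

Lemma cpderivB al f g : smooth D f -> smooth D g ->
  {in D, cpderiv al (fun x => f x - g x) =1
         (fun x => cpderiv al f x - cpderiv al g x)}.
Proof.
move=> [f1 f2] [g1 g2] x Dx; rewrite /cpderiv.
have EB : forall u v : E -> R, smooth_real D u -> smooth_real D v ->
    pderivs (word al) (fun y => u y - v y) x =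
    pderivs (word al) u x - pderivs (word al) v x.
  move=> u v su sv; have := pderivs_comb oD (word al) 1 (- 1) su sv Dx.
  rewrite mul1r mulN1r => <-; congr (pderivs _ _ x).
  by apply/funext => y; rewrite mul1r mulN1r.
rewrite -[RHS]/(_ +i* _)%C -!EB//; congr (pderivs _ _ x +i* pderivs _ _ x)%C;
  by apply/funext => y; rewrite raddfB.
Qed.

Lemma smoothB f g : smooth D f -> smooth D g -> smooth D (fun x => f x - g x).
Proof.
move=> [f1 f2] [g1 g2].
have EB : forall u v : E -> R, smooth_real D u -> smooth_real D v ->
    smooth_real D (fun y => u y - v y).
  move=> u v su sv; have := smooth_comb oD 1 (- 1) su sv.
  by congr smooth_real; apply/funext => y; rewrite mul1r mulN1r.
split.
  have := EB _ _ f1 g1.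
  by congr smooth_real; apply/funext => y; rewrite raddfB.
have := EB _ _ f2 g2.
by congr smooth_real; apply/funext => y; rewrite raddfB.
Qed.

Lemma ReM (a b : C) : complex.Re (a * b) = complex.Re a * complex.Re b + - complex.Im a * complex.Im b.
Proof. by case: a b => [? ?] [? ?] /=; rewrite mulNr. Qed.
Lemma ImM (a b : C) : complex.Im (a * b) = complex.Im a * complex.Re b + complex.Re a * complex.Im b.
Proof. by case: a b => [? ?] [? ?] /=; rewrite addrC. Qed.

Lemma smoothM (a : C) f : smooth D f -> smooth D (fun x => a * f x).
Proof.
move=> [f1 f2]; split.
  have := smooth_comb oD (complex.Re a) (- complex.Im a) f1 f2.
  by congr smooth_real; apply/funext => y; rewrite ReM.
have := smooth_comb oD (complex.Im a) (complex.Re a) f1 f2.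
by congr smooth_real; apply/funext => y; rewrite ImM.
Qed.

Lemma cpderivM al (a : C) f : smooth D f ->
  {in D, cpderiv al (fun x => a * f x) =1 (fun x => a * cpderiv al f x)}.
Proof.
move=> [f1 f2] x Dx; rewrite /cpderiv.
have -> : (fun y => complex.Re (a * f y)) = (fun y => complex.Re a * complex.Re (f y) + - complex.Im a * complex.Im (f y)).
  by apply/funext => y; rewrite ReM.
have -> : (fun y => complex.Im (a * f y)) = (fun y => complex.Im a * complex.Re (f y) + complex.Re a * complex.Im (f y)).
  by apply/funext => y; rewrite ImM.
rewrite !(pderivs_comb oD _ _ _ f1 f2 Dx).
case: a => a1 a2 /=; set p := pderivs _ _ x; set q := pderivs _ _ x.
rewrite -[RHS]/((a1 * p - a2 * q) +i* (a1 * q + a2 * p))%C.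
by congr (_ +i* _)%C; rewrite ?mulNr// addrC.
Qed.

Lemma smooth_cpderiv al f : smooth D f -> smooth D (cpderiv al f).
Proof. by move=> [f1 f2]; split; exact: smooth_pderivs. Qed.

Lemma cpderivD al be f : smooth D f ->
  {in D, cpderiv be (cpderiv al f) =1 cpderiv (fun i => (be i + al i)%N) f}.
Proof.
move=> [f1 f2] x Dx; rewrite /cpderiv -!pderivs_cat.
by rewrite !(pderivs_perm oD (perm_word be al) _ Dx).
Qed.

Lemma pderivs0 s : pderivs s (fun _ : E => 0 : R) = fun=> 0.
Proof.
elim: s => //= j s ->; apply/funext => x; exact: derive_cst.
Qed.

Lemma smooth0 : smooth D (fun=> 0).
Proof.
suff S : smooth_real D (fun=> 0) by [].
move=> s x Dx; rewrite pderivs0; split=> [|j]; first exact: cst_continuous.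
exact: derivable_cst.
Qed.

Lemma cpderiv0 al x : cpderiv al (fun=> 0) x = 0.
Proof. by rewrite /cpderiv pderivs0. Qed.

End Cpderiv.

Section GRules.
Variables (R : realType).
Local Notation C := (Rcomplex R).

Lemma normc_ge0 (z : C) : 0 <= Normc.normc z.
Proof. exact: (normr_ge0 (z : C)). Qed.
Lemma normcB (z w : C) : Normc.normc (z - w) <= Normc.normc z + Normc.normc w.
Proof. exact: (@ler_normB R C). Qed.

Lemma moderate_cst (z : C) : (fun _ : I01 R => z) \in @moderate_num R C.
Proof.
by apply/moderate_numP; apply: mod_bound_le (mod_boundC _ (Normc.normc z)) => e x _.
Qed.

Definition mnum_cst (z : C) : mnum C := Mnum (moderate_cst z).
End GRules.

Record opens (R : realType) (n : nat) := Opens {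
  opens_set :> set 'rV[R]_n;
  opens_open : open opens_set }.
Arguments opens_open {R n} o.

Section Colombeau.
Variables (R : realType) (n : nat).
Local Notation E := 'rV[R]_n.
Local Notation C := (Rcomplex R).
Local Notation normc := (@Normc.normc R).

Section Algebra.
Variable D : opens R n.
Implicit Types (u v : I01 R -> E -> C).

Definition moderate_fun : {pred (I01 R -> E -> C)} :=
  [pred u : I01 R -> E -> C |
    `[< (forall e, smooth D (u e)) /\
        forall K, compact K -> K `<=` D -> forall al : 'I_n -> nat,
          exists N : nat, bigO_on K (fun e x => normc (cpderiv al (u e) x))
                                    (fun e => (val e) ^- N) >] ].

Lemma moderate_funP u : reflect ((forall e, smooth D (u e)) /\
   forall K, compact K -> K `<=` D -> forall al : 'I_n -> nat,
      mod_bound K (fun e x => normc (cpderiv al (u e) x))) (u \in moderate_fun).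
Proof. exact: asboolP. Qed.

Fact moderate_fun_zmod : zmod_closed moderate_fun.
Proof.
split=> [|u v /moderate_funP[su Hu] /moderate_funP[sv Hv]]; apply/moderate_funP.
  split=> [e|K _ _ al]; first exact: smooth0.
  apply: mod_bound_le (mod_bound0 _ _) => e x _.
  by rewrite [cpderiv _ _ _]cpderiv0 Normc.normc0.
split=> [e|K cK KD al].
  exact: (smoothB (opens_open D) (su e) (sv e)).
apply: mod_bound_le (mod_boundD (Hu K cK KD al) (Hv K cK KD al)) => e x /KD Dx.
rewrite [cpderiv _ _ _](cpderivB (opens_open D) _ (su e) (sv e)) ?inE//.
exact: normcB.
Qed.
HB.instance Definition _ :=
  GRing.isZmodClosed.Build (I01 R -> E -> C) moderate_fun moderate_fun_zmod.

(* E_M(D) with total functions as values; two nets that agree on D differ by an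
   element of [negligible_fun], so that the quotient [Galg] is G(D). *)
Record mfun := Mfun {
  mfun_net :> I01 R -> E -> C;
  mfun_moderate : mfun_net \in moderate_fun }.
HB.instance Definition _ := [isSub for mfun_net].
HB.instance Definition _ := [Choice of mfun by <:].
HB.instance Definition _ := [SubChoice_isSubZmodule of mfun by <:].

Definition negligible_fun : {pred mfun} := [pred u : mfun |
  `[< forall K, compact K -> K `<=` D -> forall al : 'I_n -> nat, forall q : nat,
        bigO_on K (fun e x => normc (cpderiv al (u e) x))
                  (fun e => (val e) ^+ q) >] ].

Lemma negligible_funP (u : mfun) : reflect (
   forall K, compact K -> K `<=` D -> forall al : 'I_n -> nat,
      neg_bound K (fun e x => normc (cpderiv al (u e) x))) (u \in negligible_fun).
Proof. exact: asboolP. Qed.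

Lemma mfun_smooth (u : mfun) e : smooth D (u e).
Proof. by have /moderate_funP[] := mfun_moderate u. Qed.

Fact negligible_fun_zmod : zmod_closed negligible_fun.
Proof.
split=> [|u v /negligible_funP Hu /negligible_funP Hv]; apply/negligible_funP => K cK KD al.
  apply: neg_bound_le (neg_bound0 _ _) => e x _.
  by rewrite [cpderiv _ _ _]cpderiv0 Normc.normc0.
apply: neg_bound_le (neg_boundD (Hu K cK KD al) (Hv K cK KD al)) => e x /KD Dx.
rewrite [cpderiv _ _ _](cpderivB (opens_open D) _ (mfun_smooth u e) (mfun_smooth v e)) ?inE//.
exact: normcB.
Qed.
HB.instance Definition _ :=
  GRing.isZmodClosed.Build mfun negligible_fun negligible_fun_zmod.

Definition Galg := Quotient.quot negligible_fun.
HB.instance Definition _ := GRing.Zmodule.on Galg.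
HB.instance Definition _ := ZmodQuotient.on Galg.

Fact mscale_subproof (c : mnum C) (u : mfun) :
  (fun e x => c e * u e x) \in moderate_fun.
Proof.
have /moderate_numP Hc := mnum_moderate c; have /moderate_funP[su Hu] := mfun_moderate u.
apply/moderate_funP; split=> [e|K cK KD al].
  exact: (smoothM (opens_open D) (c e) (su e)).
have Hc' : mod_bound K (fun e _ => normc (c e)).
  by have [N H] := Hc; exists N; apply: bigO_const.
apply: mod_bound_le (mod_boundM _ _ Hc' (Hu K cK KD al)) => [e x /KD Dx|e x|e x];
  rewrite ?normc_ge0//.
by rewrite (cpderivM (opens_open D) _ _ (su e)) ?inE// Normc.normcM.
Qed.
Definition mscale (c : mnum C) (u : mfun) : mfun := Mfun (mscale_subproof c u).

Fact mpartial_subproof (al : 'I_n -> nat) (u : mfun) :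
  (fun e => cpderiv al (u e)) \in moderate_fun.
Proof.
have /moderate_funP[su Hu] := mfun_moderate u.
apply/moderate_funP; split=> [e|K cK KD be]; first exact: smooth_cpderiv.
apply: mod_bound_le (Hu K cK KD (fun i => be i + al i)%N) => e x /KD Dx.
by rewrite (cpderivD (opens_open D)) ?inE.
Qed.
Definition mpartial (al : 'I_n -> nat) (u : mfun) : mfun := Mfun (mpartial_subproof al u).

(* Operations on classes are defined on the representatives chosen by [repr];
   the lemmas gscale_pi, gD_pi, grestr_pi, gRe_pi, gIm_pi, gabs_pi and valuation_pi
   below show that the choice is immaterial. *)
Definition gscale (c : Ctilde R) (u : Galg) : Galg :=
  \pi_Galg (mscale (repr c) (repr u)).

(* D^al = (- i)^|al| d^al *)
Definition gD (al : 'I_n -> nat) (u : Galg) : Galg :=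
  \pi_Galg (mscale (mnum_cst ((- 'i%C : C) ^+ (\sum_i al i)%N)) (mpartial al (repr u))).

Definition Ginfty (u : Galg) : Prop :=
  exists w : mfun, \pi_Galg w = u /\
    forall K, compact K -> K `<=` D -> exists N : nat, forall al : 'I_n -> nat,
      bigO_on K (fun e x => normc (cpderiv al (w e) x))
                (fun e => (val e) ^- N).

End Algebra.

Fact mrestr_subproof (D V : opens R n) (VD : V `<=` D) (u : mfun D) :
  (u : I01 R -> E -> C) \in moderate_fun V.
Proof.
have /moderate_funP[su Hu] := mfun_moderate u; apply/moderate_funP; split=> [e|K cK KV].
  by have [s1 s2] := su e; split=> s x /VD; [apply: s1|apply: s2].
by apply: Hu => //; exact: subset_trans VD.
Qed.

Definition mrestr (D V : opens R n) (VD : V `<=` D) (u : mfun D) : mfun V :=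
  Mfun (mrestr_subproof VD u).

Definition grestr (D V : opens R n) (VD : V `<=` D) (u : Galg D) : Galg V :=
  \pi_(Galg V) (mrestr VD (repr u)).

Definition sing_supp (D : opens R n) (u : Galg D) : set E :=
  [set x | opens_set D x /\
    ~ exists (V : opens R n) (VD : V `<=` D),
        opens_set V x /\ Ginfty (grestr VD u)].

End Colombeau.

Section Points.
Variable R : realType.
Local Notation C := (Rcomplex R).

(* Euclidean norm; the library norm of 'rV[R]_n is the sup norm. *)
Definition enorm (n : nat) (x : 'I_n -> R) : R := Num.sqrt (\sum_i x i ^+ 2).

Lemma enorm_ge0 (n : nat) (x : 'I_n -> R) : 0 <= enorm x.
Proof. exact: sqrtr_ge0. Qed.

Lemma enorm_le (n : nat) (x : 'I_n -> R) : enorm x <= \sum_i `|x i|.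
Proof.
suff [t0 H] : 0 <= \sum_i `|x i| /\ \sum_i x i ^+ 2 <= (\sum_i `|x i|) ^+ 2.
  by rewrite -[leRHS]ger0_norm// -sqrtr_sqr ler_wsqrtr.
elim/big_ind2: _ => [|a b a' b' [b0 ab] [b'0 ab']|i _]; first by rewrite expr0n.
  split; first exact: addr_ge0.
  rewrite sqrrD -addrA (addrC _ (b' ^+ 2)) addrA (le_trans (lerD ab ab'))//.
  by rewrite lerDl mulrn_wge0// mulr_ge0.
by rewrite real_normK ?num_real.
Qed.

Lemma abs_Re_le (z : C) : `|complex.Re z| <= Normc.normc z.
Proof. by case: z => a b /=; rewrite -sqrtr_sqr ler_wsqrtr// lerDl sqr_ge0. Qed.
Lemma abs_Im_le (z : C) : `|complex.Im z| <= Normc.normc z.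
Proof. by case: z => a b /=; rewrite -sqrtr_sqr ler_wsqrtr// lerDr sqr_ge0. Qed.

Fact Re_subproof (c : mnum C) :
  (fun e => complex.Re (c e)) \in @moderate_num R R.
Proof.
have /moderate_numP Hc := mnum_moderate c; apply/moderate_numP.
by apply: mod_bound_le Hc => e x _; exact: abs_Re_le.
Qed.

Fact Im_subproof (c : mnum C) :
  (fun e => complex.Im (c e)) \in @moderate_num R R.
Proof.
have /moderate_numP Hc := mnum_moderate c; apply/moderate_numP.
by apply: mod_bound_le Hc => e x _; exact: abs_Im_le.
Qed.

Definition gRe (z : Ctilde R) : Rtilde R :=
  \pi_(Rtilde R) (Mnum (Re_subproof (repr z))).
Definition gIm (z : Ctilde R) : Rtilde R :=
  \pi_(Rtilde R) (Mnum (Im_subproof (repr z))).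

Fact enorm_subproof (n : nat) (x : 'I_n -> mnum R) :
  (fun e => enorm (fun i => x i e)) \in @moderate_num R R.
Proof.
apply/moderate_numP.
apply: (@mod_bound_le _ _ _ _ (fun e _ => \sum_i `|x i e|)) => [e _ _|].
  by rewrite ger0_norm ?enorm_ge0// enorm_le.
elim: (index_enum _) => [|i r IH].
  by apply: mod_bound_le (mod_bound0 _ _) => e ? _; rewrite big_nil.
have /moderate_numP Hi := mnum_moderate (x i).
by apply: mod_bound_le (mod_boundD Hi IH) => e ? _; rewrite big_cons.
Qed.

Definition gabs (n : nat) (x : 'I_n -> Rtilde R) : Rtilde R :=
  \pi_(Rtilde R) (Mnum (enorm_subproof (fun i => repr (x i)))).

Definition valuation (c : Rtilde R) : \bar R :=
  ereal_sup [set b%:E | b in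
    [set b : R | bigO (fun e => `|repr c e|) (fun e => val e `^ b)]].

Definition log_type (n : nat) (x : 'I_n -> Rtilde R) : Prop :=
  exists xe : 'I_n -> mnum R, (forall i, \pi_(Rtilde R) (xe i) = x i) /\
    bigO (fun e => enorm (fun i => xe i e)) (fun e => ln (val e)^-1).

End Points.

Section WellDefined.
Variables (R : realType).
Local Notation C := (Rcomplex R).

Lemma quot_eqP (Z : zmodType) (I : zmodClosed Z) (x y : Z) :
  \pi_(Quotient.quot I) x = \pi_(Quotient.quot I) y <-> x - y \in (I : {pred Z}).
Proof.
split=> [/eqP|H]; last apply/eqP.
  by rewrite -[X in is_true X](Quotient.idealrBE I x y).
by rewrite -[X in is_true X](Quotient.idealrBE I x y).
Qed.

Lemma repr_quot (Z : zmodType) (I : zmodClosed Z) (x : Z) :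
  repr (\pi_(Quotient.quot I) x) - x \in (I : {pred Z}).
Proof. by apply/quot_eqP; rewrite reprK. Qed.

Lemma gRe_pi (c : mnum C) :
  gRe (\pi_(Ctilde R) c) = \pi_(Rtilde R) (Mnum (Re_subproof c)).
Proof.
apply/quot_eqP/negligible_numP.
have /negligible_numP := repr_quot (@negligible_num R C) c.
apply: neg_bound_le => e x _; apply: le_trans (abs_Re_le _).
by rewrite raddfB.
Qed.

Lemma gIm_pi (c : mnum C) :
  gIm (\pi_(Ctilde R) c) = \pi_(Rtilde R) (Mnum (Im_subproof c)).
Proof.
apply/quot_eqP/negligible_numP.
have /negligible_numP := repr_quot (@negligible_num R C) c.
apply: neg_bound_le => e x _; apply: le_trans (abs_Im_le _).
by rewrite raddfB.
Qed.

Lemma enorm_sub (n : nat) (x y : 'I_n -> R) :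
  `|enorm x - enorm y| <= \sum_i `|x i - y i|.
Proof.
have H (u v : 'I_n -> R) : enorm u <= enorm v + \sum_i `|u i - v i|.
  have S0 : 0 <= \sum_i `|u i - v i| by rewrite sumr_ge0.
  have T0 : 0 <= enorm v + \sum_i `|u i - v i| by rewrite addr_ge0 ?enorm_ge0.
  rewrite -[leRHS]ger0_norm// -sqrtr_sqr ler_wsqrtr// sqrrD.
  have -> : enorm v ^+ 2 = \sum_i v i ^+ 2.
    by rewrite sqr_sqrtr// sumr_ge0// => i _; exact: sqr_ge0.
  have vi i : `|v i| <= enorm v.
    rewrite -sqrtr_sqr ler_wsqrtr// (bigD1 i)//= lerDl sumr_ge0// => j _.
    exact: sqr_ge0.
  have SS : \sum_i (u i - v i) ^+ 2 <= (\sum_i `|u i - v i|) ^+ 2.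
    have := enorm_le (fun i => u i - v i).
    rewrite -(@ler_pXn2r _ 2)// ?nnegrE ?enorm_ge0// sqr_sqrtr//.
    by apply: sumr_ge0 => i _; exact: sqr_ge0.
  have VS : \sum_i (v i * (u i - v i) *+ 2) <= enorm v * (\sum_i `|u i - v i|) *+ 2.
    rewrite sumrMnl mulr_sumr lerMn2r/=; apply: ler_sum => i _.
    by rewrite (le_trans (ler_norm _))// normrM ler_wpM2r.
  apply: le_trans (lerD (lerD (lexx _) VS) SS).
  rewrite -!big_split/= ler_sum// => i _.
  by rewrite -sqrrD addrC subrK.
rewrite ler_norml; apply/andP; split.
  rewrite lerNl opprB lerBlDl (le_trans (H y x))// lerD2l.
  by apply: ler_sum => i _; rewrite distrC.
by rewrite lerBlDl.
Qed.

Lemma gabs_pi (n : nat) (x : 'I_n -> mnum R) :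
  gabs (fun i => \pi_(Rtilde R) (x i)) = \pi_(Rtilde R) (Mnum (enorm_subproof x)).
Proof.
apply/quot_eqP/negligible_numP.
set y : 'I_n -> mnum R := fun i => repr (\pi_(Rtilde R) (x i)).
apply: (@neg_bound_le _ _ _ _ (fun e _ => \sum_i `|y i e - x i e|)) => [e _ _|].
  exact: enorm_sub.
elim: (index_enum _) => [|i r IH].
  by apply: neg_bound_le (neg_bound0 _ _) => e ? _; rewrite big_nil.
have /negligible_numP Hi := repr_quot (@negligible_num R R) (x i).
by apply: neg_bound_le (neg_boundD Hi IH) => e ? _; rewrite big_cons.
Qed.

Lemma valuation_pi (c : mnum R) : valuation (\pi_(Rtilde R) c) =
  ereal_sup [set b%:E | b in
    [set b : R | bigO (fun e => `|c e|) (fun e => val e `^ b)]].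
Proof.
have E (c1 c2 : mnum R) (b : R) : c1 - c2 \in @negligible_num R R ->
    bigO (fun e => `|c2 e|) (fun e => val e `^ b) ->
    bigO (fun e => `|c1 e|) (fun e => val e `^ b).
  move=> /negligible_numP /(_ (Num.truncn `|b|).+1) H1 H2.
  have {}H1 : bigO (fun e => `|(c1 - c2) e|) (fun e => val e `^ b).
    apply: bigO_on_ler H1 => e; have e0 := I01_gt0 e.
    rewrite exprn_ge0 ?(ltW e0)//= -powR_mulrn ?(ltW e0)//.
    rewrite ger_powR ?e0 ?I01_le1//.
    rewrite (le_trans (ler_norm _))// ltW//.
    exact: truncnS_gt.
  apply: (bigO_on_le _ (bigO_onD H1 H2)) => e _ _.
  apply: le_trans (ler_normD _ _); by rewrite [X in _ <= `|X + _|]/= subrK.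
have H := repr_quot (@negligible_num R R) c.
rewrite /valuation; congr ereal_sup; apply/seteqP; split=> _ [b Hb <-]; exists b => //.
  apply: E Hb.
  by rewrite -opprB rpredN.
exact: E Hb.
Qed.

End WellDefined.

Section WellDefinedFun.
Variables (R : realType) (n : nat) (D : opens R n).
Local Notation C := (Rcomplex R).

Lemma negl_scale (c : mnum C) (u : mfun D) :
  u \in @negligible_fun R n D -> mscale c u \in @negligible_fun R n D.
Proof.
move=> /negligible_funP H; apply/negligible_funP => K cK KD al.
have /moderate_numP [N Hc] := mnum_moderate c.
have Hc' : mod_bound K (fun e _ => Normc.normc (c e)).
  by exists N; apply: bigO_const.
apply: neg_bound_le (neg_boundM _ _ Hc' (H K cK KD al)) => [e x /KD Dx|e x|e x];
  rewrite ?normc_ge0//.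
by rewrite (cpderivM (opens_open D) _ _ (mfun_smooth u e)) ?inE// Normc.normcM.
Qed.

Lemma negl_scalel (c : mnum C) (u : mfun D) :
  c \in @negligible_num R C -> mscale c u \in @negligible_fun R n D.
Proof.
move=> /negligible_numP Hc; apply/negligible_funP => K cK KD al.
have /moderate_funP[su Hu] := mfun_moderate u.
have Hc' : neg_bound K (fun e _ => Normc.normc (c e)).
  by move=> q; apply: bigO_const; exact: Hc.
apply: neg_bound_le (neg_boundM _ _ (Hu K cK KD al) Hc') => [e x /KD Dx|e x|e x];
  rewrite ?normc_ge0//.
by rewrite (cpderivM (opens_open D) _ _ (su e)) ?inE// Normc.normcM mulrC.
Qed.

Lemma negl_partial al (u : mfun D) :
  u \in @negligible_fun R n D -> mpartial al u \in @negligible_fun R n D.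
Proof.
move=> /negligible_funP H; apply/negligible_funP => K cK KD be.
apply: neg_bound_le (H K cK KD (fun i => be i + al i)%N) => e x /KD Dx.
by rewrite (cpderivD (opens_open D) _ _ (mfun_smooth u e)) ?inE.
Qed.

Lemma negl_eq (u v : mfun D) : (forall e, {in opens_set D, u e =1 v e}) ->
  u \in @negligible_fun R n D -> v \in @negligible_fun R n D.
Proof.
move=> uv /negligible_funP H; apply/negligible_funP => K cK KD al.
apply: neg_bound_le (H K cK KD al) => e x /KD Dx.
rewrite [X in _ <= Normc.normc X](_ : _ = cpderiv al (v e) x)//.
by congr (_ +i* _)%C; apply: (pderivs_eq (opens_open D) _ _ _) => [y Dy|];
  rewrite ?inE ?uv.
Qed.

Lemma gscale_pi (c : mnum C) (u : mfun D) :
  gscale (\pi_(Ctilde R) c) (\pi_(Galg D) u) = \pi_(Galg D) (mscale c u).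
Proof.
apply/quot_eqP.
set c' := repr _; set u' := repr _.
have -> : mscale c' u' - mscale c u = mscale (c' - c) u' + mscale c (u' - u).
  apply/val_inj/funext => e; apply/funext => x.
  rewrite -[LHS]/(c' e * u' e x - c e * u e x).
  by rewrite -[RHS]/((c' e - c e) * u' e x + c e * (u' e x - u e x)) mulrBl mulrBr subrKA.
rewrite rpredD//.
  by apply: negl_scalel; exact: (repr_quot (@negligible_num R C)).
by apply: negl_scale; exact: (repr_quot (@negligible_fun R n D)).
Qed.

Lemma gD_pi al (u : mfun D) : gD al (\pi_(Galg D) u) =
  \pi_(Galg D) (mscale (mnum_cst ((- 'i%C : C) ^+ (\sum_i al i)%N)) (mpartial al u)).
Proof.
apply/quot_eqP; set c := mnum_cst _; set u' := repr _.
have H : mscale c (mpartial al (u' - u)) \in @negligible_fun R n D.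
  by apply/negl_scale/negl_partial; exact: (repr_quot (@negligible_fun R n D)).
apply: negl_eq H => e x Dx.
rewrite -[RHS]/(c e * cpderiv al (u' e) x - c e * cpderiv al (u e) x) -mulrBr.
by rewrite -(cpderivB (opens_open D) al (mfun_smooth u' e) (mfun_smooth u e) Dx).
Qed.

Lemma grestr_pi (V : opens R n) (VD : V `<=` D) (u : mfun D) :
  grestr VD (\pi_(Galg D) u) = \pi_(Galg V) (mrestr VD u).
Proof.
apply/quot_eqP/negligible_funP => K cK KV al.
have /negligible_funP := repr_quot (@negligible_fun R n D) u; apply => //.
exact: subset_trans VD.
Qed.

End WellDefinedFun.

Section Operators.
Variables (R : realType) (n m : nat).

(* Coefficients of a polynomial of degree at most m in n variables; entries with
   |al| > m are ignored. *)
Definition gpoly : Type := {ffun 'I_n -> 'I_m.+1} -> Ctilde R.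

Definition peval (c : gpoly) (z : 'I_n -> Ctilde R) : Ctilde R :=
  \sum_(al : {ffun 'I_n -> 'I_m.+1} | (\sum_i al i <= m)%N)
    c al * \prod_i z i ^+ al i.

Definition pdiff (c : gpoly) (D : opens R n) (u : Galg D) : Galg D :=
  \sum_(al : {ffun 'I_n -> 'I_m.+1} | (\sum_i al i <= m)%N)
    gscale (c al) (gD (fun i => al i) u).

Definition Ginfty_hypoelliptic (c : gpoly) : Prop :=
  forall (D : opens R n) (u : Galg D), sing_supp (pdiff c u) = sing_supp u.

Definition log_zeros (c : gpoly) : set ('I_n -> Ctilde R) :=
  [set z | peval c z = 0 /\ log_type (fun i => gIm (z i))].

End Operators.

(* Main.v *)
Require Import Defs.
From mathcomp Require Import all_boot all_order all_algebra.
From mathcomp Require Import reals constructive_ereal.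
From mathcomp Require Import generic_quotient ring_quotient complex.
From mathcomp Require Import boolp classical_sets functions ereal.
From mathcomp Require Import topology normedtype sequences derive exp trigo.
From mathcomp Require Import ring.

Set Implicit Arguments.
Unset Strict Implicit.
Unset Printing Implicit Defensive.
Import Order.TTheory GRing.Theory Num.Theory numFieldNormedType.Exports.
Local Open Scope classical_set_scope.
Local Open Scope ring_scope.
Local Open Scope quotient_scope.

(** The exponential waves x |-> exp(i x.z), z in C^n, are the simplest functions
    that P(D) multiplies by P(z). Write e for the small parameter epsilon. If
    zeta = [z_e] is a zero of P, the net u_e(x) = exp(i x.z_e) should therefore
    be a generalized solution of P(D) u = 0 (pdiff_wave). The log-type condition
    on Im zeta is what makes u an element of G(R^n): |u_e(x)| = exp(- x.Im z_e)
    is at most exp(C |x| log(1/e)) = e^(- C |x|) (wave_net_bound), and a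
    derivative only contributes a monomial in the moderate numbers i z_e.

    Hypoellipticity now forces u to be G^oo near the origin, because the
    singular support of 0 is empty.  So one exponent N controls all the
    derivatives of u at 0 (Ginfty_deriv_bound).  But u_e(0) = 1, hence the k-th
    derivative of u_e at 0 in the direction j has modulus |z_(e,j)|^k, and
    |z_(e,j)|^k = O(e^(-N)) for every k.  Taking k-th roots,
    |z_(e,j)| = O(e^(-N/k)) for every k (bigO_powR_exprn), so the valuation of
    |Re zeta| is at least - N/k for all k, that is, nonnegative. *)

(** * Exponential waves and their derivatives *)

Section CExp.
Variable R : realType.
Local Notation C := (Rcomplex R).

Definition cexp (z : C) : C :=
  ((expR (complex.Re z) * cos (complex.Im z)) +i* (expR (complex.Re z) * sin (complex.Im z)))%C.

Lemma cexp0 : cexp 0 = 1.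
Proof. by rewrite /cexp/= expR0 cos0 sin0 !mul1r. Qed.

Lemma normc_cexp (z : C) : Normc.normc (cexp z) = expR (complex.Re z).
Proof.
by rewrite /cexp/= !exprMn -mulrDr cos2Dsin2 mulr1 sqrtr_sqr ger0_norm ?expR_ge0.
Qed.

(** Reduces a directional derivative to the one-variable derivative rules. *)
Lemma is_derive_from_line (V : normedModType R) (f : V -> R) (x v : V) (l : R) :
  is_derive (0 : R) 1 (fun s => f (x + s *: v)) l -> is_derive x v f l.
Proof.
have E : (fun h : R => h^-1 *: (((fun s => f (x + s *: v)) \o shift 0) (h *: 1) -
    f (x + 0 *: v))) =
  (fun h => h^-1 *: ((f \o shift x) (h *: v) - f x)).
  apply/funext => h /=; rewrite scale0r addr0 addr0 [h%:A]mulr1.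
  by rewrite (addrC x).
by case; rewrite /derivable /derive E => d1 d2; split.
Qed.

Lemma is_derive_cexp_affine (c z a : C) (t : R) :
  is_derive t 1 (fun s : R => complex.Re (c * cexp (z + s *: a)))
    (complex.Re (c * a * cexp (z + t *: a))).
Proof.
case: c z a => [c1 c2] [z1 z2] [a1 a2].
have E : (fun s : R => complex.Re (((c1 +i* c2)%C : C) *
      cexp (((z1 +i* z2)%C : C) + s *: ((a1 +i* a2)%C : C)))) =
  (fun s : R => c1 * (expR (z1 + s * a1) * cos (z2 + s * a2)) -
     c2 * (expR (z1 + s * a1) * sin (z2 + s * a2))).
  by apply/funext => s.
rewrite E.
apply: is_derive_eq.
by rewrite /= !scaler0 !add0r !mul1r /GRing.scale/= !mulr1; ring.
Qed.

Variable n : nat.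
Local Notation E := 'rV[R]_n.

(** The pairing of a real point with a complex frequency; the space variable
    is the scalar because C is seen here as a real vector space. *)
Definition clin (a : 'I_n -> C) (x : E) : C := \sum_j x 0 j *: a j.

Lemma clin_line a x j (s : R) : clin a (x + s *: delta_mx 0 j) = clin a x + s *: a j.
Proof.
rewrite /clin (bigD1 j)//= [in RHS](bigD1 j)//= addrAC -scalerDl; congr (_ *: _ + _).
  by rewrite !mxE !eqxx mulr1.
by apply: eq_bigr => k kj; rewrite !mxE (negbTE kj) andbF mulr0 addr0.
Qed.

Lemma clin0 a : clin a 0 = 0.
Proof. by rewrite /clin big1// => j _; rewrite mxE scale0r. Qed.

(** Real parts of multiples of x |-> exp(a.x).  Unlike the real and imaginary
    parts of the exponential taken alone, this family of real functions is
    stable under partial derivatives: the j-th one replaces c by c * a_j. *)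
Definition cwave (a : 'I_n -> C) (c : C) (x : E) : R :=
  complex.Re (c * cexp (clin a x)).

Lemma is_derive_cwave a c x j :
  is_derive x (delta_mx 0 j) (cwave a c) (cwave a (c * a j) x).
Proof.
apply: is_derive_from_line; rewrite /cwave.
under [fun s : R => _]funext do rewrite clin_line.
by have := is_derive_cexp_affine c (clin a x) (a j) 0; rewrite scale0r addr0.
Qed.

Lemma continuous_clin_coord (a : 'I_n -> C) (f : C -> R) : f 0 = 0 ->
  {morph f : z w / z + w} -> (forall (r : R) z, f (r *: z) = r * f z) ->
  continuous (fun x => f (clin a x)).
Proof.
move=> f0 fD fZ; rewrite /clin.
under [fun x : E => _]funext do (rewrite (big_morph f fD f0); under eq_bigr do rewrite fZ).
apply: (@continuous_big _ _ +%R 0 xpredT) => [|j _ x].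
  by move=> z; exact: add_continuous.
apply: continuousM; first exact: coord_continuous.
exact: cst_continuous.
Qed.

(** Continuity is proved over an abstract topological space, where the
    neighbourhood filter does not unfold into the product filter of matrices. *)
Lemma continuous_Re_cexp (T : topologicalType) (f : T -> C) (c : C) :
  continuous (fun x => complex.Re (f x)) -> continuous (fun x => complex.Im (f x)) ->
  continuous (fun x => complex.Re (c * cexp (f x))).
Proof.
case: c => c1 c2 cRe cIm x.
have cE := continuous_comp (cRe x) (@continuous_expR R _).
have cC := continuous_comp (cIm x) (@continuous_cos R _).
have cS := continuous_comp (cIm x) (@continuous_sin R _).
apply: cvgB; apply: cvgM; try exact: cvg_cst.
  exact: continuousM cE cC.
exact: continuousM cE cS.
Qed.

Lemma continuous_cwave a c : continuous (cwave a c).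
Proof.
apply: continuous_Re_cexp.
  by apply: (@continuous_clin_coord a (@complex.Re R)) => [|[z1 z2] [w1 w2]|r []].
by apply: (@continuous_clin_coord a (@complex.Im R)) => [|[z1 z2] [w1 w2]|r []].
Qed.

Lemma pderivs_cwave a c s : pderivs s (cwave a c) = cwave a (c * \prod_(j <- s) a j).
Proof.
elim: s => [|j s IH] /=; first by rewrite big_nil mulr1.
rewrite IH; apply/funext => x; have [_ ->] := is_derive_cwave a (c * \prod_(j <- s) a j) x j.
by rewrite big_cons mulrA mulrAC.
Qed.

Lemma smooth_cwave a c D : smooth_real D (cwave a c).
Proof.
move=> s x _; rewrite pderivs_cwave; split=> [|j]; first exact: continuous_cwave.
by have [] := is_derive_cwave a (c * \prod_(j <- s) a j) x j.
Qed.

Lemma Re_cwave a : (fun x => complex.Re (cexp (clin a x))) = cwave a 1.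
Proof. by apply/funext => x; rewrite /cwave mul1r. Qed.

(** The imaginary part of w is the real part of - i w. *)
Lemma Im_cwave a : (fun x => complex.Im (cexp (clin a x))) = cwave a (- 'i%C).
Proof.
apply/funext => x; rewrite /cwave; case: (cexp _) => u v.
by rewrite Defs.ReM /=; ring.
Qed.

Lemma smooth_cexp_clin a D : smooth D (fun x => cexp (clin a x)).
Proof. by split; rewrite ?Re_cwave ?Im_cwave; exact: smooth_cwave. Qed.

Lemma prod_word (a : 'I_n -> C) (al : 'I_n -> nat) :
  \prod_(j <- word al) a j = \prod_j a j ^+ al j.
Proof.
rewrite /word big_flatten big_map -[RHS]big_enum/=.
by apply: eq_bigr => j _; rewrite big_nseq iter_mulr_1.
Qed.

Lemma cpderiv_cexp_clin a al x : cpderiv al (fun x => cexp (clin a x)) x =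
  \prod_j a j ^+ al j * cexp (clin a x).
Proof.
rewrite /cpderiv Re_cwave Im_cwave !pderivs_cwave prod_word mul1r /cwave.
set z := \prod_j _; set w := cexp _; rewrite -mulrA.
case: (z * w) => u v.
by congr (_ +i* _)%C; rewrite Defs.ReM /=; ring.
Qed.
End CExp.

(** * Norm estimates *)

Section NormEstimates.
Variables (R : realType) (n : nat).
Local Notation C := (Rcomplex R).

Lemma normcX (z : C) k : Normc.normc (z ^+ k) = Normc.normc z ^+ k.
Proof.
elim: k => [|k IH]; first exact: Normc.normc1.
by rewrite !exprS Normc.normcM IH.
Qed.

Lemma normc_i : Normc.normc 'i%C = 1 :> R.
Proof. by rewrite /= expr0n expr1n add0r sqrtr1. Qed.

Lemma normc_le_ReIm (u v : R) : Normc.normc (u +i* v)%C <= `|u| + `|v|.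
Proof.
have uv0 : 0 <= `|u| + `|v| by rewrite addr_ge0.
rewrite /= -[leRHS]ger0_norm// -sqrtr_sqr ler_wsqrtr// sqrrD.
by rewrite !real_normK ?num_real// addrAC lerDl mulrn_wge0// mulr_ge0.
Qed.

Lemma abs_le_enorm (x : 'I_n -> R) i : `|x i| <= enorm x.
Proof.
rewrite -sqrtr_sqr ler_wsqrtr// (bigD1 i)//= lerDl sumr_ge0// => j _.
exact: sqr_ge0.
Qed.

End NormEstimates.

(** * Growth in the parameter *)

Section Growth.
Variables (R : realType) (n : nat).

(** Comparing k-th powers with a bound e^(-N) that is independent of k gives
    g_e = O(e^(-N/k)), where N/k is as small as desired. *)
Lemma bigO_powR_exprn (g : I01 R -> R) (N : nat) : (forall e, 0 <= g e) ->
  (forall k : nat, bigO (fun e => g e ^+ k) (fun e => val e ^- N)) ->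
  forall b : R, b < 0 -> bigO g (fun e => val e `^ b).
Proof.
move=> g0 H b b0.
(* With this k, the exponent N/k is at most - b. *)
pose k := (Num.truncn (N%:R / - b)).+1.
have [A [e0 [e0_gt0 HA]]] := H k.
exists (`|A| + 1), e0; split=> // e ee0 t _.
have e_gt0 := I01_gt0 e.
(* The constant is at least 1, so that its k-th power still dominates A. *)
have A1 : 1 <= `|A| + 1 by rewrite lerDr.
rewrite -(@ler_pXn2r _ k)// ?nnegrE ?mulr_ge0 ?powR_ge0// ?(le_trans ler01)//.
have eN : 0 <= val e ^- N by rewrite invr_ge0 exprn_ge0// ltW.
have bk : b * k%:R <= - N%:R.
  have nb : 0 < - b by rewrite oppr_gt0.
  rewrite lerNr -mulNr mulrC -ler_pdivrMr// ltW//; exact: truncnS_gt.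
apply: le_trans (HA e ee0 tt I) _.
apply: (@le_trans _ _ ((`|A| + 1) ^+ k * val e ^- N)).
  rewrite ler_wpM2r// (@le_trans _ _ (`|A| + 1)) ?ler_eXnr//.
  by rewrite (le_trans (ler_norm A))// lerDl.
rewrite exprMn ler_wpM2l ?exprn_ge0 ?(le_trans ler01)//.
rewrite -[leRHS]powR_mulrn ?powR_ge0// -powRrM.
rewrite -powR_mulrn ?(ltW e_gt0)// -powRN ger_powR ?e_gt0 ?I01_le1//.
Qed.

Lemma valuation_gabs_ge0 (z : 'I_n -> mnum R) :
  (forall j (b : R), b < 0 -> bigO (fun e => `|z j e|) (fun e => val e `^ b)) ->
  (0 <= valuation (gabs (fun i => \pi_(Rtilde R) (z i))))%E.
Proof.
move=> H; rewrite gabs_pi valuation_pi.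
apply/lee_addgt0Pr => d d0; rewrite -leeBlDr// sub0e.
apply: ereal_sup_ubound; exists (- d) => //=.
have d0' : - d < 0 by rewrite oppr_lt0.
apply: (@bigO_on_le _ _ _ _ (fun e _ => \sum_j `|z j e|)) => [e _ _|].
  by rewrite ger0_norm ?enorm_ge0// enorm_le.
elim: (index_enum _) => [|j r IH].
  by apply: bigO_on_le (bigO_on0 _ _) => e ? _; rewrite big_nil.
by apply: bigO_on_le (bigO_onD (H j (- d) d0') IH) => e ? _; rewrite big_cons.
Qed.

End Growth.

(** * Evaluation of nets, and classes of generalized functions *)

Section Classes.
Variables (R : realType) (n : nat).
Local Notation C := (Rcomplex R).
Local Notation E := 'rV[R]_n.

Lemma mnum_prodX (z : 'I_n -> mnum C) (al : 'I_n -> nat) e :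
  (\prod_j z j ^+ al j : mnum C) e = \prod_j z j e ^+ al j.
Proof.
rewrite (big_morph (fun c : mnum C => c e) (op1 := *%R) (id1 := 1))//.
apply: eq_bigr => j _; elim: (al j) => [//|k IH]; by rewrite !exprS -IH.
Qed.

Lemma mnum_sum (I : finType) (Q : pred I) (f : I -> mnum C) e :
  (\sum_(i | Q i) f i : mnum C) e = \sum_(i | Q i) f i e.
Proof. by rewrite (big_morph (fun c : mnum C => c e) (op1 := +%R) (id1 := 0)). Qed.

Lemma mfun_sum (D : opens R n) (I : finType) (Q : pred I) (f : I -> mfun D) e x :
  (\sum_(i | Q i) f i : mfun D) e x = \sum_(i | Q i) f i e x.
Proof. by rewrite (big_morph (fun c : mfun D => c e x) (op1 := +%R) (id1 := 0)). Qed.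

Lemma gscale0 (D : opens R n) (u : Galg D) : gscale 0 u = 0.
Proof.
rewrite -[u]reprK -(rmorph0 (\pi_(Ctilde R))) gscale_pi.
rewrite -[RHS](raddf0 (\pi_(Galg D))); apply/quot_eqP; rewrite subr0.
by apply: negl_scalel; exact: rpred0.
Qed.

Lemma Ginfty0 (D : opens R n) : Ginfty (0 : Galg D).
Proof.
exists 0; split; first exact: raddf0.
move=> K _ _; exists 0%N => al; apply: bigO_on_le (bigO_on0 _ _) => e x _.
by rewrite [cpderiv _ _ _]cpderiv0 Normc.normc0.
Qed.

Lemma sing_supp0 (D : opens R n) : sing_supp (0 : Galg D) = set0.
Proof.
apply/seteqP; split=> x //= [Dx]; apply.
exists D, (@subset_refl _ D); split=> //.
rewrite -(raddf0 (\pi_(Galg D))) grestr_pi.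
rewrite (_ : mrestr _ 0 = 0); last exact: val_inj.
by rewrite raddf0; exact: Ginfty0.
Qed.

(** Ginfty bounds one representative of the class.  Any other one satisfies the
    same bounds, as the difference is negligible: O(e^0) is already enough,
    since e^(-N) >= 1, and thus N stays the same for all derivatives. *)
Lemma Ginfty_deriv_bound (V : opens R n) (u : mfun V) (K : set E) :
  Ginfty (\pi_(Galg V) u) -> compact K -> K `<=` V ->
  exists N : nat, forall al : 'I_n -> nat,
    bigO_on K (fun e x => Normc.normc (cpderiv al (u e) x)) (fun e => val e ^- N).
Proof.
move=> [w [/quot_eqP/negligible_funP wu Hw]] cK KV.
have [N HN] := Hw K cK KV; exists N => al.
have H0 := wu K cK KV al 0%N.
have {}H0 : bigO_on K (fun e x => Normc.normc (cpderiv al ((w - u) e) x)) (fun e => val e ^- N).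
  apply: bigO_on_ler H0 => e; rewrite expr0 ler01/=.
  by rewrite invr_ge1 ?unitfE ?exprn_gt0 ?expf_neq0 ?gt_eqF ?I01_gt0// exprn_ile1 ?I01_le1// ltW ?I01_gt0.
apply: bigO_on_le (bigO_onD (HN al) H0) => e x Kx.
rewrite [cpderiv al ((w - u) e) x](cpderivB (opens_open V) al (mfun_smooth w e) (mfun_smooth u e)) ?inE; last exact: KV.
set p := cpderiv _ (w e) _; set q := cpderiv _ _ _.
rewrite -[q in leLHS](subKr p); exact: normcB.
Qed.

End Classes.

(** * The wave with generalized frequency *)

Section Wave.
Variables (R : realType) (n : nat).
Local Notation C := (Rcomplex R).
Local Notation E := 'rV[R]_n.

Definition wave_net (z : 'I_n -> mnum C) (e : I01 R) (x : E) : C :=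
  cexp (clin (fun j => 'i%C * z j e) x).

Lemma compact_coord_bounded (K : set E) : compact K ->
  exists M : R, 0 <= M /\ forall x, K x -> forall j, `|x 0 j| <= M.
Proof.
move=> /compact_bounded[M [_ HM]]; exists `|M + 1|; split=> // x Kx j.
have := HM (`|M + 1|); rewrite (lt_le_trans _ (ler_norm _)) ?ltrDl// => /(_ isT x Kx).
apply: le_trans; rewrite [leRHS]/Num.Def.normr/= mx_normrE.
exact: (le_bigmax _ _ (0, j)).
Qed.

Lemma Re_clin_bound (a : 'I_n -> C) (x : E) (M : R) :
  (forall j, `|x 0 j| <= M) ->
  complex.Re (clin a x) <= M * \sum_j `|complex.Re (a j)|.
Proof.
move=> xM; rewrite /clin (big_morph (@complex.Re R) (id1 := 0) (op1 := +%R))//; last first.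
  by move=> [? ?] [? ?].
rewrite mulr_sumr; apply: ler_sum => j _.
have -> : complex.Re (x 0 j *: a j : C) = x 0 j * complex.Re (a j) by case: (a j).
by rewrite (le_trans (ler_norm _))// normrM ler_wpM2r.
Qed.

(** This is where the log-type condition is used: it turns the exponential
    growth exp(- x.Im z_e) into a power of 1/e, with an exponent proportional to
    the size of the compact set. *)
Lemma wave_net_bound (z : 'I_n -> mnum C) (K : set E) :
  bigO (fun e => enorm (fun j => complex.Im (z j e))) (fun e => ln (val e)^-1) ->
  compact K -> mod_bound K (fun e x => Normc.normc (wave_net z e x)).
Proof.
move=> [A [e0 [e0_gt0 HA]]] /compact_coord_bounded[M [M0 HM]].
pose N := (Num.truncn (M * (n%:R * `|A|))).+1.
exists N, 1, e0; split=> // e ee0 x Kx.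
have e_gt0 := I01_gt0 e; have e_le1 := I01_le1 e.
have L0 : 0 <= ln (val e)^-1 by rewrite ln_ge0// invr_ge1 ?unitfE ?gt_eqF.
rewrite mul1r normc_cexp -[leRHS]lnK ?posrE ?invr_gt0 ?exprn_gt0// ler_expR.
rewrite -exprVn lnXn ?invr_gt0// -mulr_natl.
apply: le_trans (Re_clin_bound _ (HM x Kx)) _.
have H j : `|complex.Re ('i%C * z j e)| <= `|A| * ln (val e)^-1.
  have -> : complex.Re ('i%C * z j e) = - complex.Im (z j e).
    by case: (z j e) => u v /=; rewrite mul0r mul1r sub0r.
  rewrite normrN (le_trans (abs_le_enorm (fun j => complex.Im (z j e)) j))//.
  rewrite (le_trans (HA e ee0 tt I))//.
  by rewrite ler_wpM2r ?ler_norm.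
apply: (@le_trans _ _ (M * (n%:R * (`|A| * ln (val e)^-1)))).
  rewrite ler_wpM2l// (le_trans (ler_sum _ (fun j _ => H j)))//.
  by rewrite sumr_const card_ord mulr_natl.
rewrite !mulrA ler_wpM2r// -mulrA ltW//.
exact: truncnS_gt.
Qed.

Lemma wave_moderate (D : opens R n) (z : 'I_n -> mnum C) :
  bigO (fun e => enorm (fun j => complex.Im (z j e))) (fun e => ln (val e)^-1) ->
  wave_net z \in moderate_fun D.
Proof.
move=> Hz; apply/moderate_funP; split=> [e|K cK _ al]; first exact: smooth_cexp_clin.
pose a j : mnum C := mnum_cst 'i%C * z j.
have /moderate_numP[N Ha] := mnum_moderate (\prod_j a j ^+ al j).
have Ha' : mod_bound K (fun e _ => Normc.normc ((\prod_j a j ^+ al j : mnum C) e)).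
  by exists N; apply: bigO_const.
apply: mod_bound_le (mod_boundM _ _ Ha' (wave_net_bound Hz cK)) => [e x Kx|e x|e x];
  rewrite ?normc_ge0//.
by rewrite cpderiv_cexp_clin Normc.normcM mnum_prodX.
Qed.

(** The log-type condition speaks of some representative of Im zeta; it is
    transferred to zeta by replacing the imaginary part of a given
    representative of zeta. *)
Lemma log_type_repr (zeta : 'I_n -> Ctilde R) : log_type (fun i => gIm (zeta i)) ->
  exists z : 'I_n -> mnum C, (forall i, \pi_(Ctilde R) (z i) = zeta i) /\
   bigO (fun e => enorm (fun j => complex.Im (z j e))) (fun e => ln (val e)^-1).
Proof.
move=> [xe [Hxe Ho]].
have Hm i : (fun e => (complex.Re (repr (zeta i) e) +i* xe i e)%C : C) \in @moderate_num R C.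
  have /moderate_numP H1 := mnum_moderate (repr (zeta i)).
  have /moderate_numP H2 := mnum_moderate (xe i).
  apply/moderate_numP; apply: mod_bound_le (mod_boundD H1 H2) => e x _.
  apply: le_trans (normc_le_ReIm _ _) _.
  by rewrite lerD2r abs_Re_le.
exists (fun i => Mnum (Hm i)); split=> // i.
rewrite -[RHS]reprK; apply/quot_eqP/negligible_numP.
have := Hxe i; rewrite /gIm => /quot_eqP/negligible_numP.
apply: neg_bound_le => e _ _.
have -> : (Mnum (Hm i) - repr (zeta i)) e =
   (0 +i* (xe i e - complex.Im (repr (zeta i) e)))%C :> C.
  rewrite -[LHS]/((complex.Re (repr (zeta i) e) +i* xe i e)%C - repr (zeta i) e : C).
  by case: (repr (zeta i) e) => u v /=; congr (_ +i* _)%C; rewrite subrr.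
by apply: le_trans (normc_le_ReIm _ _) _; rewrite normr0 add0r.
Qed.

Lemma peval_pi (m : nat) (P : gpoly R n m) (z : 'I_n -> mnum C) :
  peval P (fun i => \pi_(Ctilde R) (z i)) =
  \pi_(Ctilde R) (\sum_(al : {ffun 'I_n -> 'I_m.+1} | (\sum_i al i <= m)%N)
     repr (P al) * \prod_i z i ^+ al i).
Proof.
rewrite rmorph_sum; apply: eq_bigr => al _.
rewrite rmorphM rmorph_prod/= reprK; congr (_ * _); apply: eq_bigr => i _.
by rewrite rmorphXn.
Qed.

(** D = - i d, and the factor - i cancels the i of exp(i x.z), whence the
    monomial z^al. *)
Lemma gD_wave (D : opens R n) (z : 'I_n -> mnum C) (w : mfun D) (al : 'I_n -> nat) :
  w = wave_net z :> (I01 R -> E -> C) ->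
  gD al (\pi_(Galg D) w) = \pi_(Galg D) (mscale (\prod_i z i ^+ al i) w).
Proof.
move=> wE; rewrite gD_pi; congr (\pi_(Galg D) _).
apply/val_inj/funext => e; apply/funext => x.
rewrite -[LHS]/((- 'i%C : C) ^+ (\sum_i al i)%N * cpderiv al (w e) x).
rewrite -[RHS]/((\prod_i z i ^+ al i : mnum C) e * w e x).
rewrite wE cpderiv_cexp_clin mnum_prodX mulrA; congr (_ * _).
under [X in _ * X]eq_bigr do rewrite exprMn.
rewrite big_split/= mulrA expr_sum -big_split/= big1 ?mul1r// => j _.
by rewrite -exprMn mulNr -expr2 sqr_i opprK expr1n.
Qed.

(** A wave is an eigenvector of every constant coefficient operator, the
    eigenvalue being the value of the symbol at its frequency. *)
Lemma pdiff_wave (m : nat) (P : gpoly R n m) (D : opens R n) (z : 'I_n -> mnum C)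
    (w : mfun D) : w = wave_net z :> (I01 R -> E -> C) ->
  pdiff P (\pi_(Galg D) w) =
  gscale (peval P (fun i => \pi_(Ctilde R) (z i))) (\pi_(Galg D) w).
Proof.
move=> wE; rewrite peval_pi gscale_pi /pdiff.
transitivity (\sum_(al : {ffun 'I_n -> 'I_m.+1} | (\sum_i al i <= m)%N)
   \pi_(Galg D) (mscale (repr (P al) * \prod_i z i ^+ al i) w)).
  apply: eq_bigr => al _; rewrite (gD_wave _ wE) -{1}[P al]reprK gscale_pi.
  congr (\pi_(Galg D) _); apply/val_inj/funext => e; apply/funext => x.
  exact: mulrA.
rewrite -raddf_sum; congr (\pi_(Galg D) _).
apply/val_inj/funext => e; apply/funext => x.
rewrite [LHS]mfun_sum.
rewrite -[RHS]/((\sum_(al : {ffun 'I_n -> 'I_m.+1} | (\sum_i al i <= m)%N)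
     repr (P al) * \prod_i z i ^+ al i : mnum C) e * w e x).
by rewrite mnum_sum mulr_suml.
Qed.

End Wave.

(** * Zeros of hypoelliptic polynomials *)

Theorem theorem4p5 (R : realType) (n m : nat) (P : gpoly R n m) :
  Ginfty_hypoelliptic P ->
  forall zeta : 'I_n -> Ctilde R, log_zeros P zeta ->
    (0 <= valuation (gabs (fun i => gRe (zeta i))))%E.
Proof.
move=> hypo zeta [Pz /log_type_repr[z [zE logz]]].
have {}zE : zeta = fun i => \pi_(Ctilde R) (z i) by apply/funext => i; rewrite zE.
subst zeta.
under [fun i => gRe _]funext do rewrite gRe_pi.
pose D : opens R n := Opens openT.
pose w : mfun D := Mfun (wave_moderate D logz).
have : sing_supp (\pi_(Galg D) w) = set0.
  by rewrite -hypo (pdiff_wave P (w := w) erefl) Pz gscale0 sing_supp0.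
move=> /seteqP[/(_ 0) + _]; rewrite /sing_supp/= => s0.
have [V [VD [V0]]] : exists (V : opens R n) (VD : V `<=` D),
    opens_set V 0 /\ Ginfty (grestr VD (\pi_(Galg D) w)).
  by apply: contrapT => s; apply: s0.
rewrite grestr_pi => wV.
have [_ ->//|N HN] := Ginfty_deriv_bound wV (@compact_set1 _ (0 : 'rV[R]_n)).
apply: valuation_gabs_ge0 => j b b0.
apply: (@bigO_on_le _ _ _ _ (fun e _ => Normc.normc (z j e))) => [e _ _|].
  exact: abs_Re_le.
apply: (@bigO_powR_exprn R _ N) => // [e|k]; first exact: normc_ge0.
(* The pure derivative of order k in direction j multiplies the wave by (i z_j)^k. *)
have [A [e0 [e0_gt0 HA]]] := HN (fun i => if i == j then k else 0)%N.
exists A, e0; split=> // e ee0 _ _.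
have := HA e ee0 (0 : 'rV[R]_n) erefl; rewrite cpderiv_cexp_clin.
rewrite clin0 cexp0 mulr1 (bigD1 j)//= eqxx big1; last first.
  by move=> i ij; rewrite (negbTE ij) expr0.
by rewrite mulr1 normcX Normc.normcM normc_i mul1r.
Qed.
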